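(* Let $\mathbb{F}$ be a field of characteristic not $2$, let $n\ge 1$, and let $\mathcal{E}$ be a finite-dimensional nilpotent evolution algebra over $\mathbb{F}$. (i) If $\mathcal{E}$ is of type $[1,n]$, then $\mathcal{E}$ is isomorphic to $\mathcal{E}(\mathcal{U},b)$ for some admissible pair $(\mathcal{U},b)$. Moreover, for two admissible pairs $(\mathcal{U},b)$ and $(\mathcal{U}',b')$, $\mathcal{E}(\mathcal{U},b)$ is isomorphic to $\mathcal{E}(\mathcal{U}',b')$ if and only if there is a similarity $\psi:(\mathcal{U},b)\to(\mathcal{U}',b')$. (ii) If $\mathcal{E}$ is of type $[1,1,n]$, then $\mathcal{E}$ is isomorphic to $\mathcal{E}(\mathcal{U},b,g)$ for some admissible triple $(\mathcal{U},b,g)$. Moreover, for two admissible triples $(\mathcal{U},b,g)$ and $(\mathcal{U}',b',g')$, $\mathcal{E}(\mathcal{U},b,g)$ is isomorphic to $\mathcal{E}(\mathcal{U}',b',g')$ if and only if there is a similarity $\psi:(\mathcal{U},b)\to(\mathcal{U}',b')$ and a scalar $\nu\in\mathbb{F}$ such that $\psi^{-1}\circ g'\circ\psi=\mu g+\mu^{-1}\nu\,\mathrm{id}$, where $\mu$ is the norm of $\psi$. (iii) If $\mathcal{E}$ is of type $[1,1,1,n]$, then $\mathcal{E}$ is isomorphic to $\mathcal{E}(\mathcal{U},b,f,g)$ for some admissible quadruple $(\mathcal{U},b,f,g)$. Moreover, for two admissible quadruples $(\mathcal{U},b,f,g)$ and $(\mathcal{U}',b',f',g')$, the algebras $\mathcal{E}(\mathcal{U},b,f,g)$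 and $\mathcal{E}(\mathcal{U}',b',f',g')$ are isomorphic if and only if there is a similarity $\psi:(\mathcal{U},b)\to(\mathcal{U}',b')$ and a scalar $\nu\in\mathbb{F}$ such that $\psi^{-1}\circ f'\circ\psi=\mu f$ and $\psi^{-1}\circ g'\circ\psi=\mu^3 g+\mu^{-1}\nu\,\mathrm{id}$, where $\mu$ is the norm of $\psi$.
   Context: An evolution algebra (finite-dimensional here) is an algebra $\mathcal{E}$ over $\mathbb{F}$ with a basis $\{e_1,\ldots,e_n\}$ (a natural basis) such that $e_ie_j=0$ for $i\neq j$; it is automatically commutative, and need not be associative. For an algebra $\mathcal{A}$, $\mathrm{ann}(\mathcal{A})=\{x\in\mathcal{A}: x\mathcal{A}=\mathcal{A}x=0\}$, $\mathrm{ann}^0(\mathcal{A})=0$, and $\mathrm{ann}^i(\mathcal{A})$ is defined by $\mathrm{ann}^i(\mathcal{A})/\mathrm{ann}^{i-1}(\mathcal{A})=\mathrm{ann}(\mathcal{A}/\mathrm{ann}^{i-1}(\mathcal{A}))$. With $\mathcal{A}^1=\mathcal{A}$ and $\mathcal{A}^{k+1}=\sum_{i=1}^k\mathcal{A}^i\mathcal{A}^{k+1-i}$, $\mathcal{A}$ is nilpotent if $\mathcal{A}^m=0$ for some $m$, equivalently $\mathrm{ann}^r(\mathcal{A})=\mathcal{A}$ for some $r$. The type of a finite-dimensional nilpotent algebra $\mathcal{A}$ is the sequence $[n_1,\ldots,n_r]$, where $r$ is the least natural number with $\mathrm{ann}^r(\mathcal{A})=\mathcal{A}$ and $n_i=\dim\mathrm{ann}^i(\mathcal{A})-\dim\mathrm{ann}^{i-1}(\mathcal{A})$.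 In the following, $\mathcal{U}$ is a nonzero finite-dimensional $\mathbb{F}$-vector space and $b:\mathcal{U}\times\mathcal{U}\to\mathbb{F}$ a nondegenerate symmetric bilinear form; $(\mathcal{U},b)$ is then an admissible pair. A triple $(\mathcal{U},b,g)$ is admissible if moreover $g:\mathcal{U}\to\mathcal{U}$ is a diagonalizable endomorphism that is symmetric relative to $b$ (i.e. $b(g(u),v)=b(u,g(v))$). A quadruple $(\mathcal{U},b,f,g)$ is admissible if moreover $f,g:\mathcal{U}\to\mathcal{U}$ are commuting, diagonalizable endomorphisms, symmetric relative to $b$. The associated algebras are: - $\mathcal{E}(\mathcal{U},b)=\mathcal{U}\times\mathbb{F}$ with $(u,\alpha)(v,\beta)=(0,b(u,v))$; - $\mathcal{E}(\mathcal{U},b,g)=\mathcal{U}\times\mathbb{F}\times\mathbb{F}$ with $(u,\alpha,\beta)(v,\gamma,\delta)=(0,b(u,v),b(g(u),v)+\alpha\gamma)$; - $\mathcal{E}(\mathcal{U},b,f,g)=\mathcal{U}\times\mathbb{F}\times\mathbb{F}\times\mathbb{F}$ with $(u,\alpha,\beta,\gamma)(v,\epsilon,\delta,\eta)=(0,b(u,v),b(f(u),v)+\alpha\epsilon,b(g(u),v)+\beta\delta)$. A similarity $\psi:(\mathcal{U},b)\to(\mathcal{U}',b')$ is a linear isomorphism $\psi:\mathcal{U}\to\mathcal{U}'$ for which there is a nonzero scalar $\mu\in\mathbb{F}$, called the norm of $\psi$, with $b'(\psi(u),\psi(v))=\mu b(u,v)$ for all $u,v\in\mathcal{U}$. *)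

(* Defs.v *)
From HB Require Import structures.
From mathcomp Require Import all_boot all_order all_algebra.

Set Implicit Arguments.
Unset Strict Implicit.
Unset Printing Implicit Defensive.

Import GRing.Theory.
Local Open Scope ring_scope.

(* No associativity, commutativity or unit is required. *)
Record nonassocAlg (F : fieldType) := NonassocAlg {
  nasort :> vectType F;
  namul : {bilinear nasort -> nasort -> nasort}
}.

Definition isomorphic (F : fieldType) (A B : nonassocAlg F) : Prop :=
  exists2 phi : 'Hom(A, B),
    bijective phi & forall x y, phi (namul A x y) = namul B (phi x) (phi y).

Section NonassocAlgTheory.
Variables (F : fieldType) (A : nonassocAlg F).
Implicit Types (x y : A) (I V W : {vspace A}).

Definition lmulv x : 'End(A) := linfun (namul A x).
Definition rmulv x : 'End(A) := linfun (applyr (namul A) x).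

(* For an ideal I, the preimage in A of ann(A / I): the class of x annihilates
   A / I iff xA and Ax are included in I; see mem_ann_mod, ann_mod_quotient. *)
Definition ann_mod I : {vspace A} :=
  (\bigcap_(i < \dim {:A})
     (rmulv (vbasis {:A})`_i @^-1: I :&: lmulv (vbasis {:A})`_i @^-1: I))%VS.

Lemma mem_ann_mod I x :
  (x \in ann_mod I) <->
  (forall y, namul A x y \in I /\ namul A y x \in I).
Proof.
split=> [/subv_bigcapP xP y|xP]; last first.
  apply/subv_bigcapP=> i _; rewrite -memvE memv_cap -!memv_preim !lfunE /=.
  by apply/andP; split; apply xP.
rewrite (coord_vbasis (memvf y)) linear_sumr linear_sumlz.
suff h (i : 'I_(\dim {:A})) :
    namul A x (vbasis {:A})`_i \in I /\ namul A (vbasis {:A})`_i x \in I.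
  split; apply: rpred_sum => i _.
    by rewrite linearZr_LR rpredZ //; case: (h i).
  by rewrite linearZl_LR rpredZ //; case: (h i).
have := xP i isT.
by rewrite -memvE memv_cap -!memv_preim !lfunE /= => /andP[].
Qed.

Lemma ann_mod_quotient (Q : nonassocAlg F) (p : 'Hom(A, Q)) I x :
    (forall x y, p (namul A x y) = namul Q (p x) (p y)) ->
    (forall z, exists y, p y = z) -> lker p = I ->
  (x \in ann_mod I) <->
  (forall z, namul Q (p x) z = 0 /\ namul Q z (p x) = 0).
Proof.
move=> pM p_surj <-; split=> [/mem_ann_mod h z|h]; last first.
  by apply/mem_ann_mod => y; rewrite !memv_ker !pM; have [-> ->] := h (p y).
have [y <-] := p_surj z.
by have [] := h y; rewrite !memv_ker !pM => /eqP-> /eqP->.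
Qed.

Fixpoint ann (i : nat) : {vspace A} :=
  if i is j.+1 then ann_mod (ann j) else 0%VS.

Definition prodvs V W : {vspace A} :=
  <<[seq namul A x y | x <- vbasis V, y <- vbasis W]>>%VS.

Lemma prodvs_sub V W Z :
  (prodvs V W <= Z)%VS <->
  (forall x y, x \in V -> y \in W -> namul A x y \in Z).
Proof.
split=> [/span_subvP sVW x y xV yW|h].
  rewrite (coord_vbasis xV) (coord_vbasis yW) linear_sumlz rpred_sum // => i _.
  rewrite linear_sumr rpred_sum // => j _.
  rewrite linearZl_LR linearZr_LR !rpredZ // sVW //.
  by apply/allpairsP; exists ((vbasis V)`_i, (vbasis W)`_j);
     rewrite !mem_nth ?size_tuple.
by apply/span_subvP => z /allpairsP[[x y] /= [xV yW ->]];
   apply: h; apply: vbasis_mem.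
Qed.

(* The sequence [:: A^1; ...; A^(n + 1)]; its entry of index i is A^(i + 1). *)
Fixpoint powers (n : nat) : seq {vspace A} :=
  if n is m.+1 then
    let s := powers m in
    rcons s (\sum_(i < m.+1) prodvs (nth 0 s i) (nth 0 s (m - i)))%VS
  else [:: fullv].

(* A^k for k >= 1; the value at k = 0 is immaterial (it is A). *)
Definition power (k : nat) : {vspace A} := nth 0%VS (powers k.-1) k.-1.

Lemma size_powers n : size (powers n) = n.+1.
Proof. by elim: n => //= n IHn; rewrite size_rcons IHn. Qed.

Lemma nth_powers n i : (i <= n)%N -> nth 0%VS (powers n) i = power i.+1.
Proof.
elim: n => [|n IHn]; first by case: i.
rewrite leq_eqVlt => /predU1P[-> //|lt_in].
by rewrite /= nth_rcons size_powers lt_in IHn.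
Qed.

Lemma power1 : power 1 = fullv. Proof. by []. Qed.

Lemma powerS k : (0 < k)%N ->
  power k.+1 = (\sum_(1 <= i < k.+1) prodvs (power i) (power (k.+1 - i)))%VS.
Proof.
case: k => // k _; rewrite {1}/power /= nth_rcons size_powers ltnn eqxx.
rewrite big_add1 /= big_mkord; apply: eq_bigr => i _.
have le_ik : (i <= k)%N by rewrite -ltnS.
by rewrite (nth_powers le_ik) (nth_powers (leq_subr i k)) subSS subSn.
Qed.

Definition nilpotent : Prop := exists m, power m = 0%VS.

Definition has_type (s : seq nat) : Prop :=
  exists r, [/\ ann r = fullv,
                forall k, ann k = fullv -> (r <= k)%N
              & s = mkseq (fun i => \dim (ann i.+1) - \dim (ann i))%N r].

Definition evolution_algebra : Prop :=
  exists2 e : (\dim {:A}).-tuple A,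
    basis_of fullv e & forall i j, i != j -> namul A (tnth e i) (tnth e j) = 0.

End NonassocAlgTheory.

Arguments nilpotent {F} A.
Arguments has_type {F} A s.
Arguments evolution_algebra {F} A.
Arguments power {F} A k.
Arguments ann {F} A i.

Section Admissible.
Variables (F : fieldType) (U : vectType F).

Definition ldiagonalizable (g : 'End(U)) : Prop :=
  exists2 e : (\dim {:U}).-tuple U,
    basis_of fullv e & forall i, exists a : F, g (tnth e i) = a *: tnth e i.

Definition form_symmetric (b : {symmetric U}) (g : 'End(U)) : Prop :=
  forall u v, b (g u) v = b u (g v).

Definition admissible_pair (b : {symmetric U}) : Prop :=
  \dim {:U} != 0%N /\ nondegenerate b.

Definition admissible_triple (b : {symmetric U}) (g : 'End(U)) : Prop :=
  [/\ admissible_pair b, ldiagonalizable g & form_symmetric b g].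

Definition admissible_quadruple (b : {symmetric U}) (f g : 'End(U)) : Prop :=
  [/\ admissible_pair b, (f \o g)%VF = (g \o f)%VF,
      ldiagonalizable f /\ ldiagonalizable g
    & form_symmetric b f /\ form_symmetric b g].

Section Mul.
Variables (b : {symmetric U}) (f g : 'End(U)).

Definition pair_mul (x y : U * F^o) : U * F^o :=
  let: (u, _) := x in let: (v, _) := y in (0, b u v).

Definition triple_mul (x y : U * F^o * F^o) : U * F^o * F^o :=
  let: (u, a, _) := x in let: (v, c, _) := y in
  (0, b u v, b (g u) v + a * c).

Definition quadruple_mul (x y : U * F^o * F^o * F^o) : U * F^o * F^o * F^o :=
  let: (u, a1, a2, _) := x in let: (v, c1, c2, _) := y in
  (0, b u v, b (f u) v + a1 * c1, b (g u) v + a2 * c2).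

Lemma pair_mul_bilinear : bilinear_for
  (GRing.Scale.Law.clone _ _ *:%R _) (GRing.Scale.Law.clone _ _ *:%R _) pair_mul.
Proof.
split=> [[v c]|[u c]] k [x a] [y d] /=; congr pair => /=;
  by rewrite ?(linearPl, linearPr) /= ?scaler0 ?addr0.
Qed.

HB.instance Definition _ := bilinear_isBilinear.Build F
  (U * F^o)%type (U * F^o)%type (U * F^o)%type _ _ pair_mul pair_mul_bilinear.

Lemma triple_mul_bilinear : bilinear_for
  (GRing.Scale.Law.clone _ _ *:%R _) (GRing.Scale.Law.clone _ _ *:%R _) triple_mul.
Proof.
split=> [[[v c] c']|[[u c] c']] k [[x a] a'] [[y d] d'] /=;
  congr (_, _, _) => /=;
  rewrite ?(linearP g, linearPl, linearPr) /= ?scaler0 ?addr0 //.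
  by rewrite mulrDl -scalerAl scalerDr addrACA.
by rewrite mulrDr -scalerAr scalerDr addrACA.
Qed.

HB.instance Definition _ := bilinear_isBilinear.Build F
  (U * F^o * F^o)%type (U * F^o * F^o)%type (U * F^o * F^o)%type _ _
  triple_mul triple_mul_bilinear.

Lemma quadruple_mul_bilinear : bilinear_for
  (GRing.Scale.Law.clone _ _ *:%R _) (GRing.Scale.Law.clone _ _ *:%R _) quadruple_mul.
Proof.
split=> [[[[v c] c'] c'']|[[[u c] c'] c'']]
  k [[[x a] a'] a''] [[[y d] d'] d''] /=; congr (_, _, _, _) => /=;
  rewrite ?(linearP f, linearP g, linearPl, linearPr) /= ?scaler0 ?addr0 //;
  by rewrite (mulrDl, mulrDr) -(scalerAl, scalerAr) scalerDr addrACA.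
Qed.

HB.instance Definition _ := bilinear_isBilinear.Build F
  (U * F^o * F^o * F^o)%type (U * F^o * F^o * F^o)%type
  (U * F^o * F^o * F^o)%type _ _ quadruple_mul quadruple_mul_bilinear.

Definition pairAlg : nonassocAlg F :=
  @NonassocAlg F (U * F^o)%type pair_mul.
Definition tripleAlg : nonassocAlg F :=
  @NonassocAlg F (U * F^o * F^o)%type triple_mul.
Definition quadrupleAlg : nonassocAlg F :=
  @NonassocAlg F (U * F^o * F^o * F^o)%type quadruple_mul.

End Mul.
End Admissible.

Definition is_similarity (F : fieldType) (U U' : vectType F)
    (b : {symmetric U}) (b' : {symmetric U'})
    (psi : 'Hom(U, U')) (mu : F) : Prop :=
  [/\ bijective psi, mu != 0
    & forall u v, b' (psi u) (psi v) = mu * b u v].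

(* Main.v *)
Require Import Defs.
From HB Require Import structures.
From mathcomp Require Import all_boot all_order all_algebra.
From mathcomp Require Import ring.

(* Classification.  In E(U, b, f, g) let X, Y, Z be the unit vectors of the three
   copies of F, so that X^2 = Y, Y^2 = Z and XY = 0.  These lie in successive
   terms of the series ann^i, so an isomorphism phi maps Z, Y, X to multiples of
   Z', Y', X' up to lower terms, and the three relations leave only
   phi X = mu X' + nu Z', phi Y = mu^2 Y', phi Z = mu^4 Z'.  Since UX = UY = 0,
   phi u = psi u + (multiple of Z'); comparing phi (uv) with phi u * phi v
   componentwise gives the similarity psi and the conjugation formulas.

   Existence.  Each ann^i is spanned by the natural basis vectors it contains.
   For type [1, 1, 1, n] let X be the basis vector in ann^3 outside ann^2, and
   put Y = X^2, Z = Y^2; then ann^3 is spanned by X, Y, Z, and the squares of the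
   remaining n basis vectors are p X + q Y + r Z with p nonzero.  Thus b is
   diagonal with entries p, and f, g are diagonal with entries q / p, r / p. *)

Set Implicit Arguments.
Unset Strict Implicit.
Unset Printing Implicit Defensive.

Import GRing.Theory.
Local Open Scope ring_scope.

(** * Linear bijections and isomorphisms of algebras *)

Lemma lfun_of_linear (F : fieldType) (U V : vectType F) (h : U -> V) :
  linear h -> exists f : 'Hom(U, V), f =1 h.
Proof.
move=> h_lin; pose hL := HB.pack_for {linear U -> V} h
  (GRing.isLinear.Build _ _ _ _ h h_lin).
by exists (linfun hL) => u; rewrite lfunE.
Qed.

Section BijectiveLfun.
Variables (F : fieldType) (U V : vectType F).
Implicit Type f : 'Hom(U, V).

Lemma lker0_bij f : bijective f -> lker f == 0%VS.
Proof. by move=> /bij_inj f_inj; apply/lker0P. Qed.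

Lemma bij_lfunVK f : bijective f -> cancel f^-1%VF f.
Proof.
move=> f_bij v; have [h _ hK] := f_bij.
by rewrite -[v]hK (lker0_lfunK (lker0_bij f_bij)).
Qed.

Lemma bij_lfun f :
  (forall u, f u = 0 -> u = 0) -> (forall v, exists u, f u = v) -> bijective f.
Proof.
move=> f0 f_surj.
have kf0 : lker f == 0%VS.
  rewrite -subv0; apply/subvP => u; rewrite memv_ker memv0 => /eqP/f0->.
  exact: eqxx.
exists f^-1%VF => [|v]; first exact: lker0_lfunK.
by have [u <-] := f_surj v; rewrite lker0_lfunK.
Qed.

End BijectiveLfun.

Section Isomorphisms.
Variables (F : fieldType) (A B : nonassocAlg F).

Lemma isomorphic_linear : isomorphic A B ->
  exists h : {linear A -> B},
    [/\ injective h, (forall y, exists x, h x = y)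
      & forall x y, h (namul A x y) = namul B (h x) (h y)].
Proof.
case=> phi phi_bij phiM; exists phi; split=> //; first exact: bij_inj.
by move=> y; exists (phi^-1%VF y); apply: bij_lfunVK.
Qed.

Lemma linear_isomorphic (h : A -> B) :
    linear h -> (forall x, h x = 0 -> x = 0) -> (forall y, exists x, h x = y) ->
    (forall x y, h (namul A x y) = namul B (h x) (h y)) ->
  isomorphic A B.
Proof.
move=> /lfun_of_linear[phi phiE] h0 h_surj hM; exists phi.
  apply: bij_lfun => [x|y]; first by rewrite phiE; apply: h0.
  by have [x <-] := h_surj y; exists x; apply: phiE.
by move=> x y; rewrite !phiE.
Qed.

End Isomorphisms.

(** * Nondegenerate symmetric forms and conjugation by a similarity *)

Section SymmetricForm.
Variables (F : fieldType) (U : vectType F) (b : {symmetric U}).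

Lemma nondegenerate_eq0 u :
  nondegenerate b -> (forall v, b u v = 0) -> u = 0.
Proof.
move=> /eqP b_nd bu0; apply/eqP; rewrite -memv0 -b_nd.
by apply/mem_orthovP => v _.
Qed.

Lemma nondegenerateP :
  (forall u, (forall v, b u v = 0) -> u = 0) -> nondegenerate b.
Proof.
move=> b0; rewrite /nondegenerate -subv0; apply/subvP => u /mem_orthovP bu0.
by rewrite memv0 [u]b0 // => v; rewrite bu0 ?memvf.
Qed.

Lemma eq_endo_form (h k : 'End(U)) :
  nondegenerate b -> (forall u v, b (h u) v = b (k u) v) -> h = k.
Proof.
move=> b_nd hk; apply/lfunP => u; apply/eqP; rewrite -subr_eq0; apply/eqP.
by apply: nondegenerate_eq0 => // v; rewrite linearBl /= hk subrr.
Qed.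

End SymmetricForm.

Section Transfer.
Variables (F : fieldType) (U U' : vectType F).
Variables (b : {symmetric U}) (b' : {symmetric U'}).
Variables (psi : 'Hom(U, U')) (mu : F).
Hypothesis sim : is_similarity b b' psi mu.

(** Pairing with [v] and multiplying by [mu] translates the endomorphism identity into one between
    forms, because [psi] scales [b] by [mu]; nondegeneracy of [b] gives the way back. The right-hand
    side is what comparing products in the algebras yields. *)
Lemma conj_form_eq (g : 'End(U)) (g' : 'End(U')) (s t : F) :
    nondegenerate b ->
  (psi^-1 \o g' \o psi)%VF = s *: g + (mu^-1 * t) *: \1%VF
  <-> (forall u v,
         b' (g' (psi u)) (psi v) = mu * s * b (g u) v + t * b u v).
Proof.
have [psi_bij mu_neq0 psiM] := sim => b_nd.
have VK := bij_lfunVK psi_bij.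
have bV u v : b' (g' (psi u)) (psi v) = mu * b ((psi^-1 \o g' \o psi)%VF u) v.
  by rewrite -psiM !lfunE /= lfunE /= VK.
have bR u v : mu * b ((s *: g + (mu^-1 * t) *: \1%VF) u) v
    = mu * s * b (g u) v + t * b u v.
  rewrite !lfunE /= !lfunE /= linearDl !linearZl_LR /=.
  by rewrite id_lfunE mulrDr !mulrA divff // mul1r.
split=> [e u v|e]; first by rewrite bV e bR.
by apply: (eq_endo_form b_nd) => u v; apply: (mulfI mu_neq0); rewrite -bV bR e.
Qed.

Lemma conj_form_eq0 (g : 'End(U)) (g' : 'End(U')) (s : F) :
    nondegenerate b ->
  (psi^-1 \o g' \o psi)%VF = s *: g
  <-> (forall u v, b' (g' (psi u)) (psi v) = mu * s * b (g u) v).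
Proof.
move=> b_nd; have := conj_form_eq g g' s 0 b_nd.
rewrite mulr0 scale0r addr0 => ->.
by split=> e u v; rewrite e mul0r addr0.
Qed.

End Transfer.

(** * Isomorphisms between the model algebras *)

Section Classification.
Variables (F : fieldType) (U U' : vectType F).
Variables (b : {symmetric U}) (b' : {symmetric U'}).
Variables (f g : 'End(U)) (f' g' : 'End(U')).
Hypotheses (b_nd : nondegenerate b) (b'_nd : nondegenerate b').

(** Injectivity comes for free: [psi u = 0] forces [mu * b u v = 0] for all [v], hence [u = 0]. *)
Lemma similarity_of_form (psi : 'Hom(U, U')) (mu : F) :
    mu != 0 -> (forall v, exists u, psi u = v) ->
    (forall u v, b' (psi u) (psi v) = mu * b u v) ->
  is_similarity b b' psi mu.
Proof.
move=> mu_neq0 psi_surj psiM; split=> //; apply: bij_lfun => // u u0.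
apply: (nondegenerate_eq0 b_nd) => v; apply: (mulfI mu_neq0).
by rewrite -psiM u0 linear0l mulr0.
Qed.

Lemma pair_iso_similarity :
  isomorphic (pairAlg b) (pairAlg b') ->
  exists (psi : 'Hom(U, U')) (mu : F), is_similarity b b' psi mu.
Proof.
move=> /isomorphic_linear iso.
(* The carriers are unfolded to products of spaces, so that products of explicit tuples compute. *)
have {iso} [h [h_inj h_surj hM]] :
  exists h : {linear (U * F^o)%type -> (U' * F^o)%type},
  [/\ injective h, forall y, exists x, h x = y
    & forall x y, h (pair_mul b x y) = pair_mul b' (h x) (h y)] := iso.
have [psi psiE] : exists psi : 'Hom(U, U'), forall u, psi u = (h (u, 0)).1.
  apply: (lfun_of_linear (h := fun u => (h (u, 0)).1)) => a u v.
  have -> : (a *: u + v, 0) = a *: (u, 0) + (v, 0) :> (U * F^o)%type.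
    by congr pair; rewrite /= scaler0 addr0.
  by rewrite linearP.
pose X : U * F^o := (0, 1).
(* [X] annihilates the algebra and [h] is onto, so the first component of [h X] is [b']-orthogonal
   to everything. *)
have X1 : (h X).1 = 0.
  apply: (nondegenerate_eq0 b'_nd) => v.
  have [[u c] uE] := h_surj (v, 0).
  have := hM X (u, c); rewrite uE /= linear0l linear0.
  by case: (h X) => x a [].
set mu := (h X).2.
have hX : h X = (0, mu) by rewrite -X1 /mu; case: (h X).
have hZ a : h (0, a) = (0, a * mu).
  have -> : (0, a) = a *: X by congr pair; rewrite /= ?scaler0 // [RHS]mulr1.
  by rewrite linearZ hX; congr pair; rewrite /= scaler0.
have mu_neq0 : mu != 0.
  apply/eqP => mu0; have /h_inj[/eqP] : h X = h 0.
    by rewrite hX mu0 linear0.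
  by rewrite oner_eq0.
exists psi, mu; apply: similarity_of_form => // [v|u v].
  (* A preimage of [(v, 0)] may have a scalar component [a]; dropping it leaves the [U']-component
     of the image unchanged. *)
  have [[u a] uE] := h_surj (v, 0); exists u; rewrite psiE.
  have -> : (u, 0) = (u, a) - (0, a) :> (U * F^o)%type.
    by congr pair; rewrite /= ?subr0 ?subrr.
  by rewrite linearB hZ uE /= subr0.
have := hM (u, 0) (v, 0); rewrite /= hZ !psiE mulrC.
by case: (h (u, 0)) => x c; case: (h (v, 0)) => y d [].
Qed.

Lemma similarity_pair_iso (psi : 'Hom(U, U')) (mu : F) :
  is_similarity b b' psi mu -> isomorphic (pairAlg b) (pairAlg b').
Proof.
move=> [psi_bij mu_neq0 psiM].
apply: (linear_isomorphic (h := fun x : pairAlg b =>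
          (psi x.1, mu * x.2) : pairAlg b')) => /=.
- move=> k [u a] [v c]; congr pair => /=; first exact: linearP.
  by rewrite mulrDr [mu * _]mulrCA.
- move=> [u a] /= [/eqP u0 /eqP]; rewrite mulf_eq0 (negPf mu_neq0) /= => /eqP->.
  by move: u0; rewrite -memv_ker (eqP (lker0_bij psi_bij)) memv0 => /eqP->.
- move=> [v c]; exists (psi^-1%VF v, mu^-1 * c).
  by rewrite /= bij_lfunVK // mulVKf.
- by move=> [u a] [v c]; rewrite /= psiM linear0.
Qed.


(** Here X is [(0, 1, 0)] and Z is [(0, 0, 1)], with X^2 = Z. The image of Z is forced to be mu^2
    Z', and that of X to be mu X' + nu Z'. *)
Lemma triple_iso_similarity :
  isomorphic (tripleAlg b g) (tripleAlg b' g') ->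
  exists (psi : 'Hom(U, U')) (mu nu : F), is_similarity b b' psi mu /\
    (psi^-1 \o g' \o psi)%VF = mu *: g + (mu^-1 * nu) *: \1%VF.
Proof.
move=> /isomorphic_linear iso.
have {iso} [h [h_inj h_surj hM]] :
  exists h : {linear (U * F^o * F^o)%type -> (U' * F^o * F^o)%type},
  [/\ injective h, forall y, exists x, h x = y
    & forall x y, h (triple_mul b g x y) = triple_mul b' g' (h x) (h y)] := iso.
have [psi psiE] : exists psi : 'Hom(U, U'), forall u, psi u = (h (u, 0, 0)).1.1.
  apply: (lfun_of_linear (h := fun u => (h (u, 0, 0)).1.1)) => a u v.
  have -> : (a *: u + v, 0, 0) = a *: (u, 0, 0) + (v, 0, 0)
    :> (U * F^o * F^o)%type by congr (_, _, _); rewrite /= scaler0 addr0.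
  by rewrite linearP.
(* Z annihilates the algebra, hence so does its image. Multiplying the image by [(v, 0, 0)] and by
   [(0, 1, 0)] kills its first two components. *)
have [k hZ] : exists k, h (0, 0, 1) = (0, 0, k).
  have Z0 y : triple_mul b' g' (h (0, 0, 1)) y = 0.
    have [[[u a] c] <-] := h_surj y; rewrite -hM /=.
    by rewrite linear0 !linear0l mul0r addr0 linear0.
  case: (h _) Z0 => [[z1 z2] z3] Z0; exists z3.
  have -> : z1 = 0.
    by apply: (nondegenerate_eq0 b'_nd) => v; case: (Z0 (v, 0, 0)).
  have /= [_] := Z0 (0, 1, 0).
  by rewrite !linear0r add0r mulr1 => ->.
have hZc c : h (0, 0, c) = (0, 0, c * k).
  have -> : (0, 0, c) = c *: (0, 0, 1) :> (U * F^o * F^o)%type.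
    by congr (_, _, _); rewrite /= ?scaler0 // [RHS]mulr1.
  by rewrite linearZ hZ; congr (_, _, _); rewrite /= scaler0.
have k_neq0 : k != 0.
  apply/eqP => k0; have /h_inj[/eqP] : h (0, 0, 1) = h 0.
    by rewrite hZ k0 linear0.
  by rewrite oner_eq0.
(* X times anything is a multiple of Z, so the image of X times anything has second component zero;
   that component is a value of [b']. *)
have [mu [nu hX]] : exists mu nu, h (0, 1, 0) = (0, mu, nu).
  have X0 y : exists c, triple_mul b' g' (h (0, 1, 0)) y = (0, 0, c).
    have [[[u a] c] <-] := h_surj y; exists (a * k); rewrite -hM /=.
    by rewrite linear0 !linear0l mul1r add0r hZc.
  case: (h _) X0 => [[x1 x2] x3] X0; exists x2, x3.
  have -> // : x1 = 0.
  by apply: (nondegenerate_eq0 b'_nd) => v; case: (X0 (v, 0, 0)) => c [].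
have hXY a c : h (0, a, c) = (0, a * mu, a * nu + c * k).
  have -> : (0, a, c) = a *: (0, 1, 0) + (0, 0, c) :> (U * F^o * F^o)%type.
    by congr (_, _, _); rewrite /= ?scaler0 ?add0r ?addr0 // [RHS]mulr1.
  rewrite linearD linearZ hX hZc.
  by congr (_, _, _); rewrite /= ?scaler0 ?addr0.
(* The relation X^2 = Z, which also makes [mu] nonzero. *)
have kE : k = mu * mu.
  have := hM (0, 1, 0) (0, 1, 0).
  by rewrite hX /= !linear0r !add0r mul1r hZ => -[].
have mu_neq0 : mu != 0 by apply: contraNneq k_neq0; rewrite kE => ->; rewrite mul0r.
(* The product of [(u, 0, 0)] with X is zero, so the X'-component of the image times [mu]
   vanishes. *)
have hU u : exists c, h (u, 0, 0) = (psi u, 0, c).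
  have := hM (u, 0, 0) (0, 1, 0); rewrite psiE hX /= !linear0r mul0r addr0 linear0.
  case: (h _) => [[u' a] c] [_ /eqP].
  rewrite !linear0r add0r eq_sym mulf_eq0 (negPf mu_neq0) orbF => /eqP->.
  by exists c.
have psiM u v : (0, b u v * mu, b u v * nu + b (g u) v * k)
    = (0, b' (psi u) (psi v), b' (g' (psi u)) (psi v)) :> (U' * F^o * F^o)%type.
  have [[c uE] [d vE]] := (hU u, hU v).
  by have := hM (u, 0, 0) (v, 0, 0); rewrite /= hXY uE vE /= !mul0r !addr0.
have sim : is_similarity b b' psi mu.
  apply: similarity_of_form => // [v|u v].
    have [[[u a] c] uE] := h_surj (v, 0, 0); exists u; rewrite psiE.
    have -> : (u, 0, 0) = (u, a, c) - (0, a, c) :> (U * F^o * F^o)%type.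
      by congr (_, _, _); rewrite /= ?subr0 ?subrr.
    by rewrite linearB hXY uE /= subr0.
  by have [<- _] := psiM u v; rewrite mulrC.
exists psi, mu, nu; split=> //; apply/(conj_form_eq sim) => // u v.
by have [_ <-] := psiM u v; rewrite kE; ring.
Qed.

Lemma similarity_triple_iso (psi : 'Hom(U, U')) (mu nu : F) :
    is_similarity b b' psi mu ->
    (psi^-1 \o g' \o psi)%VF = mu *: g + (mu^-1 * nu) *: \1%VF ->
  isomorphic (tripleAlg b g) (tripleAlg b' g').
Proof.
move=> sim /(conj_form_eq sim)-/(_ b_nd) gE.
have [psi_bij mu_neq0 psiM] := sim.
(* The shape found in the converse direction, with the free Z'-component on [U] taken to be zero. *)
apply: (linear_isomorphic (h := fun x : tripleAlg b g =>
          let: (u, a, c) := x in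
          (psi u, mu * a, mu ^+ 2 * c + nu * a) : tripleAlg b' g')) => /=.
- move=> k [[u a] c] [[v d] e]; congr (_, _, _) => /=; first exact: linearP.
  + have lin (s x y : F) : mu * (s * x + y) = s * (mu * x) + mu * y by ring.
    exact: lin.
  + have lin (s x y z t : F) : mu ^+ 2 * (s * x + y) + nu * (s * z + t)
        = s * (mu ^+ 2 * x + nu * z) + (mu ^+ 2 * y + nu * t) by ring.
    exact: lin.
- move=> [[u a] c] [/eqP u0 /eqP]; rewrite mulf_eq0 (negPf mu_neq0) /= => /eqP->.
  move=> /eqP; rewrite mulr0 addr0 mulf_eq0 sqrf_eq0 (negPf mu_neq0) => /eqP->.
  by move: u0; rewrite -memv_ker (eqP (lker0_bij psi_bij)) memv0 => /eqP->.
- move=> [[v c] d].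
  exists (psi^-1%VF v, mu^-1 * c, mu ^- 2 * (d - nu * (mu^-1 * c))).
  by rewrite bij_lfunVK // mulVKf // mulVKf ?expf_neq0 // subrK.
- move=> [[u a] c] [[v d] e]; rewrite /= psiM linear0 gE; congr (_, _, _).
  by ring.
Qed.

Lemma quadruple_iso_similarity :
  isomorphic (quadrupleAlg b f g) (quadrupleAlg b' f' g') ->
  exists (psi : 'Hom(U, U')) (mu nu : F),
    [/\ is_similarity b b' psi mu, (psi^-1 \o f' \o psi)%VF = mu *: f
      & (psi^-1 \o g' \o psi)%VF = mu ^+ 3 *: g + (mu^-1 * nu) *: \1%VF].
Proof.
move=> /isomorphic_linear iso.
pose Q := (U * F^o * F^o * F^o)%type; pose Q' := (U' * F^o * F^o * F^o)%type.
have {iso} [h [h_inj h_surj hM]] : exists h : {linear Q -> Q'},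
  [/\ injective h, forall y, exists x, h x = y
    & forall x y, h (quadruple_mul b f g x y)
        = quadruple_mul b' f' g' (h x) (h y)] := iso.
have [psi psiE] : exists psi : 'Hom(U, U'),
    forall u, psi u = (h (u, 0, 0, 0)).1.1.1.
  apply: (lfun_of_linear (h := fun u => (h (u, 0, 0, 0)).1.1.1)) => a u v.
  have -> : (a *: u + v, 0, 0, 0) = a *: (u, 0, 0, 0) + (v, 0, 0, 0) :> Q.
    by congr (_, _, _, _); rewrite /= scaler0 addr0.
  by rewrite linearP.
(* As for triples; the second and third components are removed by multiplying by X' and by Y'. *)
have [k hZ] : exists k, h (0, 0, 0, 1) = (0, 0, 0, k).
  have Z0 y : quadruple_mul b' f' g' (h (0, 0, 0, 1)) y = 0.
    have [[[[u a] c] d] <-] := h_surj y; rewrite -hM /=.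
    by rewrite !linear0 !linear0l !mul0r !addr0 linear0.
  case: (h _) Z0 => [[[z1 z2] z3] z4] Z0; exists z4.
  have -> : z1 = 0.
    by apply: (nondegenerate_eq0 b'_nd) => v; case: (Z0 (v, 0, 0, 0)).
  have /= [_] := Z0 (0, 1, 0, 0); rewrite !linear0r add0r mulr1 => -> _.
  have /= [_ _] := Z0 (0, 0, 1, 0).
  by rewrite !linear0r add0r mulr1 => ->.
have hZc d : h (0, 0, 0, d) = (0, 0, 0, d * k).
  have -> : (0, 0, 0, d) = d *: (0, 0, 0, 1) :> Q.
    by congr (_, _, _, _); rewrite /= ?scaler0 // [RHS]mulr1.
  by rewrite linearZ hZ; congr (_, _, _, _); rewrite /= scaler0.
have k_neq0 : k != 0.
  apply/eqP => k0; have /h_inj[/eqP] : h (0, 0, 0, 1) = h 0.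
    by rewrite hZ k0 linear0.
  by rewrite oner_eq0.
(* Y times anything is a multiple of Z. Multiplying the image by [(v, 0, 0, 0)] removes its first
   component, and by X' its second. *)
have [l [m hY]] : exists l m, h (0, 0, 1, 0) = (0, 0, l, m).
  have Y0 y : exists c, quadruple_mul b' f' g' (h (0, 0, 1, 0)) y = (0, 0, 0, c).
    have [[[[u a] c] d] <-] := h_surj y; exists (c * k); rewrite -hM /=.
    by rewrite !linear0 !linear0l mul1r mul0r !add0r hZc.
  case: (h _) Y0 => [[[y1 y2] y3] y4] Y0; exists y3, y4.
  have -> : y1 = 0.
    by apply: (nondegenerate_eq0 b'_nd) => v; case: (Y0 (v, 0, 0, 0)) => c [].
  have [c [_]] := Y0 (0, 1, 0, 0).
  by rewrite !linear0r add0r mulr1 => ->.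
have kE : k = l * l.
  have := hM (0, 0, 1, 0) (0, 0, 1, 0).
  by rewrite hY /= !linear0r !mul0r !add0r mul1r hZ => -[].
have l_neq0 : l != 0 by apply: contraNneq k_neq0; rewrite kE => ->; rewrite mul0r.
have hYZ c d : h (0, 0, c, d) = (0, 0, c * l, c * m + d * k).
  have -> : (0, 0, c, d) = c *: (0, 0, 1, 0) + (0, 0, 0, d) :> Q.
    by congr (_, _, _, _); rewrite /= ?scaler0 ?add0r ?addr0 // [RHS]mulr1.
  rewrite linearD linearZ hY hZc.
  by congr (_, _, _, _); rewrite /= ?scaler0 ?addr0.
(* X times anything lies in the span of Y and Z, which removes only the [U']-component; the
   Y'-component [t] falls next, by XY = 0. *)
have [mu [t [nu hX]]] : exists mu t nu, h (0, 1, 0, 0) = (0, mu, t, nu).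
  have X0 y : exists c d, quadruple_mul b' f' g' (h (0, 1, 0, 0)) y = (0, 0, c, d).
    have [[[[u a] c] d] <-] := h_surj y; exists (a * l), (a * m); rewrite -hM /=.
    by rewrite !linear0 !linear0l mul1r mul0r !add0r hYZ mul0r addr0.
  case: (h _) X0 => [[[x1 x2] x3] x4] X0; exists x2, x3, x4.
  have -> // : x1 = 0.
  by apply: (nondegenerate_eq0 b'_nd) => v; case: (X0 (v, 0, 0, 0)) => c [d []].
have t0 : t = 0.
  have := hM (0, 1, 0, 0) (0, 0, 1, 0); rewrite hX hY /=.
  rewrite !linear0r mul0r !mulr0 !add0r linear0 => -[/esym/eqP].
  by rewrite mulf_eq0 (negPf l_neq0) orbF => /eqP.
move: hX; rewrite {t}t0 => hX.
(* From X^2 = Y: the last component of the squared image of X is the square of its Y'-component, now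
   zero. *)
have [lE mE] : l = mu * mu /\ m = 0.
  have := hM (0, 1, 0, 0) (0, 1, 0, 0).
  by rewrite hX /= !linear0r !mul0r !add0r mul1r hY => -[].
have mu_neq0 : mu != 0 by apply: contraNneq l_neq0; rewrite lE => ->; rewrite mul0r.
have hXYZ a c d : h (0, a, c, d) = (0, a * mu, c * l, a * nu + d * k).
  have -> : (0, a, c, d) = a *: (0, 1, 0, 0) + (0, 0, c, d) :> Q.
    by congr (_, _, _, _); rewrite /= ?scaler0 ?add0r ?addr0 // [RHS]mulr1.
  rewrite linearD linearZ hX hYZ mE mulr0 add0r.
  by congr (_, _, _, _); rewrite /= ?scaler0 ?addr0 ?add0r.
have hU u : exists c, h (u, 0, 0, 0) = (psi u, 0, 0, c).
  have := hM (u, 0, 0, 0) (0, 1, 0, 0); have := hM (u, 0, 0, 0) (0, 0, 1, 0).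
  rewrite psiE hX hY /= !linear0r !mul0r !addr0 linear0.
  case: (h _) => [[[u' a] c] d] [_ _ /eqP].
  rewrite !linear0r add0r eq_sym mulf_eq0 (negPf l_neq0) orbF => /eqP->.
  case=> _ /eqP.
  rewrite !linear0r add0r eq_sym mulf_eq0 (negPf mu_neq0) orbF => /eqP-> _.
  by exists d.
have psiM u v :
    (0, b u v * mu, b (f u) v * l, b u v * nu + b (g u) v * k)
    = (0, b' (psi u) (psi v), b' (f' (psi u)) (psi v), b' (g' (psi u)) (psi v))
    :> Q'.
  have [[c uE] [d vE]] := (hU u, hU v).
  have := hM (u, 0, 0, 0) (v, 0, 0, 0).
  by rewrite /= hXYZ uE vE /= !mul0r !addr0.
have sim : is_similarity b b' psi mu.
  apply: similarity_of_form => // [v|u v].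
    have [[[[u a] c] d] uE] := h_surj (v, 0, 0, 0); exists u; rewrite psiE.
    have -> : (u, 0, 0, 0) = (u, a, c, d) - (0, a, c, d) :> Q.
      by congr (_, _, _, _); rewrite /= ?subr0 ?subrr.
    by rewrite linearB hXYZ uE /= subr0.
  by have [<- _ _] := psiM u v; rewrite mulrC.
exists psi, mu, nu; split=> //.
  apply/(conj_form_eq0 sim) => // u v.
  by have [_ <- _] := psiM u v; rewrite lE; ring.
(* Here [k] is the square of [l], so it equals [mu ^+ 4], the factor [mu * mu ^+ 3] that
   [conj_form_eq] asks for. *)
apply/(conj_form_eq sim) => // u v.
by have [_ _ <-] := psiM u v; rewrite kE lE; ring.
Qed.

Lemma similarity_quadruple_iso (psi : 'Hom(U, U')) (mu nu : F) :
    is_similarity b b' psi mu -> (psi^-1 \o f' \o psi)%VF = mu *: f ->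
    (psi^-1 \o g' \o psi)%VF = mu ^+ 3 *: g + (mu^-1 * nu) *: \1%VF ->
  isomorphic (quadrupleAlg b f g) (quadrupleAlg b' f' g').
Proof.
move=> sim /(conj_form_eq0 sim)-/(_ b_nd) fE /(conj_form_eq sim)-/(_ b_nd) gE.
have [psi_bij mu_neq0 psiM] := sim.
(* The weights 1, 2, 4 are forced by X^2 = Y and Y^2 = Z. *)
apply: (linear_isomorphic (h := fun x : quadrupleAlg b f g =>
          let: (u, a, c, d) := x in
          (psi u, mu * a, mu ^+ 2 * c, mu ^+ 4 * d + nu * a)
            : quadrupleAlg b' f' g')) => /=.
- move=> k [[[u a] c] d] [[[v a'] c'] d'].
  congr (_, _, _, _) => /=; first exact: linearP.
  + have lin (s x y : F) : mu * (s * x + y) = s * (mu * x) + mu * y by ring.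
    exact: lin.
  + have lin (s x y : F) :
      mu ^+ 2 * (s * x + y) = s * (mu ^+ 2 * x) + mu ^+ 2 * y by ring.
    exact: lin.
  + have lin (s x y z t : F) : mu ^+ 4 * (s * x + y) + nu * (s * z + t)
        = s * (mu ^+ 4 * x + nu * z) + (mu ^+ 4 * y + nu * t) by ring.
    exact: lin.
- move=> [[[u a] c] d] [/eqP u0 /eqP]; rewrite mulf_eq0 (negPf mu_neq0) => /eqP->.
  move=> /eqP; rewrite mulf_eq0 expf_eq0 (negPf mu_neq0) => /eqP->.
  move=> /eqP; rewrite mulr0 addr0 mulf_eq0 expf_eq0 (negPf mu_neq0) => /eqP->.
  by move: u0; rewrite -memv_ker (eqP (lker0_bij psi_bij)) memv0 => /eqP->.
- move=> [[[v a] c] d].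
  exists (psi^-1%VF v, mu^-1 * a, mu ^- 2 * c,
          mu ^- 4 * (d - nu * (mu^-1 * a))).
  by rewrite bij_lfunVK // mulVKf // !mulVKf ?expf_neq0 // subrK.
- move=> [[[u a] c] d] [[[v a'] c'] d'].
  rewrite /= psiM linear0 gE fE; congr (_, _, _, _); by ring.
Qed.

End Classification.

(** * Dimension arguments for isomorphisms and for subspaces of codimension one *)

Lemma isomorphic_sym (F : fieldType) (A B : nonassocAlg F) :
  isomorphic A B -> isomorphic B A.
Proof.
case=> phi phi_bij phiM; have VK := bij_lfunVK phi_bij.
have K := lker0_lfunK (lker0_bij phi_bij).
exists phi^-1%VF => [|x y]; first by exists phi.
by rewrite -{1}[x]VK -{1}[y]VK -phiM K.
Qed.

(** Injectivity follows by rank-nullity, so the existence proofs need only generators and a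
    dimension count. *)
Lemma surjective_isomorphic (F : fieldType) (A B : nonassocAlg F) (h : A -> B) :
    \dim {:A} = \dim {:B} -> linear h -> (forall y, exists x, h x = y) ->
    (forall x y, h (namul A x y) = namul B (h x) (h y)) ->
  isomorphic A B.
Proof.
move=> dimAB h_lin h_surj hM; apply: linear_isomorphic => // x hx0.
have [phi phiE] := lfun_of_linear h_lin.
have phi_onto : limg phi = fullv.
  apply/vspaceP => y; rewrite memvf; have [z <-] := h_surj y.
  by rewrite -phiE memv_img ?memvf.
have /eqP := limg_ker_dim phi fullv.
rewrite phi_onto dimAB -[X in _ == X]add0n eqn_add2r capfv dimv_eq0 => /eqP ker0.
by apply/eqP; rewrite -memv0 -ker0 memv_ker phiE hx0.
Qed.

(** The line of [x] meets [W] trivially, so it fills the one missing dimension. This is used to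
    climb the annihilator series one step at a time. *)
Lemma vline_complement (F : fieldType) (V : vectType F) (W W' : {vspace V}) x v :
    (W <= W')%VS -> \dim W' = (\dim W).+1 ->
    x \in W' -> x \notin W -> v \in W' ->
  exists a, v - a *: x \in W.
Proof.
move=> sWW' dimW' xW' xW; suff <- : (<[x]> + W)%VS = W'.
  case/memv_addP=> _ /vlineP[a ->] [w wW ->]; exists a.
  by rewrite addrC addKr.
apply/eqP; rewrite eqEdim subv_add -memvE xW' sWW' /= dimW'.
have xW0 : (<[x]> :&: W = 0)%VS.
  apply/eqP; rewrite -subv0; apply/subvP => _ /memv_capP[/vlineP[a ->]].
  have [-> _|a0] := eqVneq a 0; first by rewrite scale0r mem0v.
  by rewrite rpredZeq (negPf a0) (negPf xW).
have := dimv_sum_cap <[x]> W; rewrite xW0 dimv0 addn0 dim_vline => ->.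
by have [x0|] := eqVneq x 0; [rewrite x0 mem0v in xW | rewrite add1n].
Qed.

(** * The annihilator series and the type *)

Section AnnSeries.
Variables (F : fieldType) (A : nonassocAlg F).

Lemma ann_subS k : (ann A k <= ann A k.+1)%VS.
Proof.
elim: k => [|k IHk]; first exact: sub0v.
apply/subvP => x /mem_ann_mod xk; apply/mem_ann_mod => y.
by have [? ?] := xk y; split; apply: (subvP IHk).
Qed.

Lemma mul_ann1 x y : x \in ann A 1 -> namul A x y = 0 /\ namul A y x = 0.
Proof.
by move=> /mem_ann_mod/(_ y); rewrite !memv0 => -[/eqP ? /eqP ?].
Qed.

(** The type is recorded by truncated subtraction; positive entries show that nothing was truncated,
    so the dimensions can be recovered. *)
Lemma has_type_dim s k : has_type A s -> all (fun i => 0 < i)%N s ->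
  (k < size s)%N -> \dim (ann A k.+1) = (\dim (ann A k) + nth 0 s k)%N.
Proof.
case=> r [_ _ ->] /all_nthP s_gt0; rewrite size_mkseq => lt_kr.
have := s_gt0 0%N k; rewrite size_mkseq => /(_ lt_kr); rewrite nth_mkseq //.
by rewrite subn_gt0 => /ltnW/subnKC.
Qed.

Lemma has_type_full s : has_type A s -> ann A (size s) = fullv.
Proof. by case=> r [? _ ->]; rewrite size_mkseq. Qed.

End AnnSeries.

(** * The annihilator series in terms of a natural basis *)

Section NaturalBasis.
Variables (F : fieldType) (A : nonassocAlg F) (e : (\dim {:A}).-tuple A).
Hypothesis e_basis : basis_of fullv e.
Hypothesis e_orth : forall i j, i != j -> namul A (tnth e i) (tnth e j) = 0.

Notation sq i := (namul A (tnth e i) (tnth e i)).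

Lemma natural_coord x : x = \sum_i coord e i x *: tnth e i.
Proof.
rewrite {1}(coord_basis e_basis (memvf x)).
by apply: eq_bigr => i _; rewrite (tnth_nth 0).
Qed.

Lemma coord_natural i j : coord e i (tnth e j) = (i == j)%:R.
Proof. by rewrite (tnth_nth 0) coord_free ?(basis_free e_basis) // eq_sym. Qed.

Lemma natural_mul x y :
  namul A x y = \sum_i (coord e i x * coord e i y) *: sq i.
Proof.
rewrite {1}(natural_coord x) linear_sumlz; apply: eq_bigr => i _.
rewrite linearZl_LR /= {1}(natural_coord y) linear_sumr (bigD1 i) //=.
rewrite big1 => [|j ji]; first by rewrite addr0 linearZr_LR scalerA.
by rewrite linearZr_LR e_orth 1?eq_sym // scaler0.
Qed.

Lemma natural_mulC x y : namul A x y = namul A y x.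
Proof. by rewrite !natural_mul; apply: eq_bigr => i _; rewrite mulrC. Qed.

Lemma mul_natural i y : namul A (tnth e i) y = coord e i y *: sq i.
Proof.
rewrite natural_mul (bigD1 i) //= coord_natural eqxx mul1r big1 ?addr0 // => j ji.
by rewrite coord_natural (negPf ji) mul0r scale0r.
Qed.

Definition level k : {set 'I_(\dim {:A})} := [set i | tnth e i \in ann A k].

(** Every product with a natural basis vector is a multiple of its square. *)
Lemma level_sq k i : (i \in level k.+1) = (sq i \in ann A k).
Proof.
rewrite inE; apply/idP/idP => [/mem_ann_mod/(_ (tnth e i))[]//|sq_i].
apply/mem_ann_mod => y; rewrite (natural_mulC y) mul_natural.
by split; apply: memvZ.
Qed.

(** Multiplying [x] by [tnth e i] isolates a nonzero multiple of [sq i]. Consequently each [ann A k]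
    is spanned by the natural basis vectors it contains. *)
Lemma ann_coord k x i : x \in ann A k -> coord e i x != 0 -> i \in level k.
Proof.
case: k => [|k].
  by rewrite memv0 => /eqP->; rewrite linear0 eqxx.
rewrite level_sq => /mem_ann_mod/(_ (tnth e i))[_].
by rewrite mul_natural rpredZeq => /orP[->|].
Qed.

Lemma coord_ann0 k x i : x \in ann A k -> i \notin level k -> coord e i x = 0.
Proof. by move=> xk; apply: contraNeq; apply: ann_coord. Qed.

Lemma dim_ann_level k : \dim (ann A k) = #|level k|.
Proof.
pose X := [seq x <- e | x \in ann A k].
have -> : #|level k| = size X.
  rewrite size_filter -[tval e]map_tnth_enum count_map cardE size_filter.
  by rewrite -enumT; apply: eq_count => i; rewrite /= inE.
have X_free : free X by apply: filter_free; apply: basis_free e_basis.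
suff <- : <<X>>%VS = ann A k by apply/eqP.
apply/eqP; rewrite eqEsubv; apply/andP; split.
  by apply/span_subvP => x; rewrite mem_filter => /andP[].
apply/subvP => x xk; rewrite (natural_coord x) rpred_sum // => i _.
have [->|xi] := eqVneq (coord e i x) 0; first by rewrite scale0r mem0v.
rewrite rpredZ // memv_span // mem_filter mem_tnth andbT.
by have := ann_coord xk xi; rewrite inE.
Qed.

Lemma exists_levelD k : (\dim (ann A k) < \dim (ann A k.+1))%N ->
  exists2 i, i \in level k.+1 & i \notin level k.
Proof.
move=> lt_dim; suff: ~~ (level k.+1 \subset level k) by case/subsetPn=> i; exists i.
by apply/negP => /subset_leq_card; rewrite -!dim_ann_level leqNgt lt_dim.
Qed.

(* Modulo ann^1, y is a nonzero multiple of a natural basis vector, whose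
   square is nonzero; elements of ann^1 do not contribute to the square of y. *)
Lemma mul_self_ann1 y : y \in ann A 2 -> y \notin ann A 1 ->
  \dim (ann A 2) = (\dim (ann A 1)).+1 -> namul A y y != 0.
Proof.
move=> y2 y1 dim2.
have [i i2 i1] : exists2 i, i \in level 2 & i \notin level 1.
  by apply: exists_levelD; rewrite dim2.
rewrite !inE in i1 i2.
have [a ya] := vline_complement (ann_subS A 1) dim2 i2 i1 y2.
have a_neq0 : a != 0.
  by apply: contraNneq y1 => a0; rewrite a0 scale0r subr0 in ya.
rewrite -[y](subrK (a *: tnth e i)) linearDl (mul_ann1 _ ya).1 add0r.
rewrite linearDr (mul_ann1 _ ya).2 add0r linearZl_LR linearZr_LR /=.
rewrite !scaler_eq0 !negb_or a_neq0 /=.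
by rewrite -memv0 -(level_sq 0) inE.
Qed.

Section Complement.
Variable k : nat.

Notation m := #|~: level k|.
Notation w j := (tnth e (enum_val (A := ~: level k) j)).

(** Row vectors model the space U: its coordinates are those along the natural basis vectors outside
    [ann A k]. *)
Definition combine (u : 'rV[F]_m) : A := \sum_j u 0 j *: w j.

Lemma combine_linear : linear combine.
Proof.
move=> a u v; rewrite /combine scaler_sumr -big_split /=; apply: eq_bigr => j _.
by rewrite !mxE scalerDl scalerA.
Qed.

Lemma combine0 : combine 0 = 0.
Proof. by rewrite /combine big1 // => j _; rewrite mxE scale0r. Qed.

Lemma combine_mul u v :
  namul A (combine u) (combine v) = \sum_j (u 0 j * v 0 j) *: namul A (w j) (w j).
Proof.
rewrite /combine linear_sumlz; apply: eq_bigr => j _.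
rewrite linearZl_LR linear_sumr (bigD1 j) //= big1 => [|j' j'j].
  by rewrite addr0 linearZr_LR scalerA.
by rewrite linearZr_LR e_orth ?scaler0 // (inj_eq enum_val_inj) eq_sym.
Qed.

Lemma combine_mul_ann u y : y \in ann A k -> namul A (combine u) y = 0.
Proof.
move=> yk; rewrite /combine linear_sumlz big1 // => j _.
rewrite linearZl_LR mul_natural (coord_ann0 yk) ?scale0r ?scaler0 //.
by have := enum_valP j; rewrite inE.
Qed.

(** The mixed products vanish, since an element of [ann A k] has no coordinate along the remaining
    basis vectors. *)
Lemma combine_add_mul u v y z : y \in ann A k -> z \in ann A k ->
  namul A (combine u + y) (combine v + z)
  = \sum_j (u 0 j * v 0 j) *: namul A (w j) (w j) + namul A y z.
Proof.
move=> yk zk; rewrite linearDl !linearDr /= combine_mul (combine_mul_ann u zk).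
by rewrite (natural_mulC y) (combine_mul_ann v yk) addr0 add0r.
Qed.

Lemma combine_onto x : exists u, x - combine u \in ann A k.
Proof.
exists (\row_j coord e (enum_val (A := ~: level k) j) x).
rewrite {1}(natural_coord x) (bigID (mem (level k))) /= -addrA rpredD //.
  by apply: rpred_sum => i; rewrite inE => ?; apply: memvZ.
rewrite (eq_bigl (mem (~: level k))) => [|i]; last by rewrite !inE.
rewrite big_enum_val /combine -sumrB big1 ?mem0v // => j _.
by rewrite mxE subrr.
Qed.

Lemma dim_complement : \dim {:A} = (m + \dim (ann A k))%N.
Proof. by rewrite dim_ann_level addnC cardsC card_ord. Qed.

End Complement.
End NaturalBasis.

(** * Diagonal forms and diagonal endomorphisms *)

Section DiagonalForm.
Variables (F : fieldType) (m : nat).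
Implicit Types (p a : 'I_m -> F) (u v : 'rV[F]_m).

Definition diag_form p u v : F := \sum_j p j * (u 0 j * v 0 j).

Lemma diag_form_bilinear p : bilinear_for
  (GRing.Scale.Law.clone _ _ *%R _) (GRing.Scale.Law.clone _ _ (idfun \; *%R) _)
  (diag_form p).
Proof.
by split=> [v|u] k x y; rewrite /diag_form /= mulr_sumr -big_split /=;
  apply: eq_bigr => j _; rewrite !mxE; ring.
Qed.

HB.instance Definition _ p := bilinear_isBilinear.Build F
  'rV[F]_m 'rV[F]_m F _ _ (diag_form p) (diag_form_bilinear p).

Lemma diag_form_sym p u v :
  diag_form p u v = (-1) ^+ false * idfun (diag_form p v u).
Proof.
rewrite expr0 mul1r; apply: eq_bigr => j _; congr (_ * _); exact: mulrC.
Qed.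

HB.instance Definition _ p := isHermitianSesquilinear.Build F
  'rV[F]_m false idfun (diag_form p) (@diag_form_sym p).

Definition diag_end a : 'End('rV[F]_m) := linfun (mulmxr (diag_mx (\row_j a j))).

Lemma diag_endE a u j : diag_end a u 0 j = a j * u 0 j.
Proof. by rewrite lfunE /= mul_mx_diag !mxE mulrC. Qed.

End DiagonalForm.

Lemma dim_row (F : fieldType) m : \dim {:'rV[F]_m} = m.
Proof. by rewrite dimvf dim_matrix mul1r. Qed.

Section Dimension.
Variables (F : fieldType) (U : vectType F) (b : {symmetric U}) (f g : 'End(U)).

Lemma dim_pair : \dim {:pairAlg b} = (\dim {:U} + 1)%N.
Proof. by rewrite !dimvf. Qed.

Lemma dim_triple : \dim {:tripleAlg b g} = (\dim {:U} + 2)%N.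
Proof. by rewrite -[2%N]/(1 + 1)%N addnA !dimvf. Qed.

Lemma dim_quadruple : \dim {:quadrupleAlg b f g} = (\dim {:U} + 3)%N.
Proof. by rewrite -[3%N]/(1 + 1 + 1)%N !addnA !dimvf. Qed.

End Dimension.

Section DiagonalAdmissible.
Variables (F : fieldType) (m : nat) (p : 'I_m -> F).
Hypotheses (m_neq0 : m != 0%N) (p_neq0 : forall j, p j != 0).
Implicit Types a c : 'I_m -> F.

Lemma diag_admissible : admissible_pair (diag_form p : {symmetric 'rV[F]_m}).
Proof.
split; first by rewrite dim_row.
apply: (@nondegenerateP _ _ (diag_form p : {symmetric _})) => u bu0.
apply/rowP => j; rewrite mxE.
(* Pairing with the [j]-th unit vector leaves only [p j * u 0 j]. *)
have := bu0 (delta_mx 0 j); rewrite /= /diag_form (bigD1 j) //= big1 => [|i ij].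
  rewrite addr0 mxE !eqxx mulr1 => /eqP.
  by rewrite mulf_eq0 (negPf (p_neq0 j)) => /eqP.
by rewrite mxE (negPf ij) andbF !mulr0.
Qed.

Lemma diag_end_diagonalizable a : ldiagonalizable (diag_end a).
Proof.
pose X := [tuple (delta_mx 0 j : 'rV[F]_m) | j < m].
have X_basis : basis_of fullv X.
  rewrite basisEfree subvf size_tuple dim_row leqnn !andbT.
  have XE (j : 'I_m) : X`_j = delta_mx 0 j by rewrite -tnth_nth tnth_mktuple.
  apply/freeP => k k0 i; have /rowP/(_ i) := k0; rewrite summxE mxE.
  rewrite (bigD1 i) //= big1 => [|j ji].
    by rewrite addr0 XE !mxE !eqxx mulr1.
  by rewrite XE !mxE eq_sym (negPf ji) andbF mulr0.
have X_eigen i : exists s, diag_end a (tnth X i) = s *: tnth X i.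
  exists (a i); rewrite tnth_mktuple; apply/rowP => j.
  by rewrite diag_endE !mxE eqxx /=; case: eqP => [->|]; rewrite ?mulr0.
(* The required length is a dimension equal to [m] only propositionally; it is generalised to [d] so
   that the equation can be eliminated. *)
suff diagP d : m = d -> exists2 e : d.-tuple 'rV[F]_m, basis_of fullv e
    & forall i, exists s, diag_end a (tnth e i) = s *: tnth e i.
  by apply: diagP; rewrite dim_row.
by move=> md; case: d / md; exists X.
Qed.

Lemma diag_end_symmetric a :
  form_symmetric (diag_form p : {symmetric 'rV[F]_m}) (diag_end a).
Proof.
move=> u v; apply: eq_bigr => j _; rewrite !diag_endE; congr (_ * _); ring.
Qed.

Lemma diag_end_comm a c :
  (diag_end a \o diag_end c)%VF = (diag_end c \o diag_end a)%VF.
Proof.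
apply/lfunP => u; rewrite [LHS]comp_lfunE [RHS]comp_lfunE; apply/rowP => j.
by rewrite !diag_endE; ring.
Qed.

Lemma diag_form_end a u v :
  diag_form p (diag_end a u) v = \sum_j p j * a j * (u 0 j * v 0 j).
Proof. by apply: eq_bigr => j _; rewrite diag_endE; ring. Qed.

End DiagonalAdmissible.

(** * Realising an evolution algebra of given type by a model *)

Section Existence.
Variables (F : fieldType) (A : nonassocAlg F) (A_evol : evolution_algebra A).
Variable n : nat.
Hypothesis n_gt0 : (0 < n)%N.

Lemma type_pair : has_type A [:: 1%N; n] ->
  exists (U : vectType F) (b : {symmetric U}),
    admissible_pair b /\ isomorphic A (pairAlg b).
Proof.
move=> tA; have [e e_basis e_orth] := A_evol.
have s_gt0 : all (fun i => 0 < i)%N [:: 1%N; n] by rewrite /= n_gt0.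
have dim1 : \dim (ann A 1) = 1%N.
  by rewrite (has_type_dim (k := 0) tA s_gt0) //= dimv0.
have full2 : ann A 2 = fullv := has_type_full tA.
have dim2 : \dim {:A} = (1 + n)%N.
  by rewrite -full2 (has_type_dim (k := 1) tA s_gt0) //= dim1.
pose m := #|~: level e 1|.
have dimA : \dim {:A} = (m + 1)%N by rewrite (dim_complement e_basis e_orth 1) dim1.
have m_neq0 : m != 0%N 
  by move: dim2; rewrite dimA addnC => /addnI->; rewrite -lt0n.
have [x x1 x0] : exists2 x, x \in level e 1 & x \notin level e 0.
  by apply: (exists_levelD e_basis e_orth); rewrite dim1 dimv0.
rewrite !inE in x1 x0; pose X := tnth e x.
have X1 : X \in ann A 1 := x1.
pose w j := tnth e (enum_val (A := ~: level e 1) j).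
have X_gen v : v \in ann A 1 -> exists a, v = a *: X.
  move=> v1; have [|a] := vline_complement (ann_subS A 0) _ x1 x0 v1.
    by rewrite dim1 dimv0.
  by rewrite memv0 subr_eq0 => /eqP ->; exists a.
have /fin_all_exists[p pE] j : exists a, namul A (w j) (w j) = a *: X.
  by apply: X_gen; rewrite -(level_sq e_basis e_orth) inE full2 memvf.
(* Otherwise the square of [w j] would be zero and [w j] would already lie in [ann A 1]. *)
have p_neq0 j : p j != 0.
  have := enum_valP j; rewrite inE (level_sq e_basis e_orth) -/(w j) pE.
  by apply: contraNneq => ->; rewrite scale0r mem0v.
exists 'rV[F]_m, (diag_form p); split; first exact: diag_admissible.
apply: isomorphic_sym.
(* The map runs from the model to [A]: it is onto by [combine_onto], and [combine_add_mul] computes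
   its products. *)
apply: (surjective_isomorphic (h := fun y : pairAlg (diag_form p) =>
  combine (e := e) y.1 + y.2 *: X)).
- by rewrite dim_pair dim_row; apply: esym.
- move=> k [u a] [v c] /=; rewrite combine_linear scalerDr scalerDl -scalerA.
  by rewrite addrACA.
- move=> v; have [u uv] := combine_onto e_basis 1 v.
  have [a aE] := X_gen _ uv.
  by exists (u, a); rewrite /= -aE addrC subrK.
- move=> [u a] [v c] /=.
  rewrite (combine_add_mul e_basis e_orth) ?memvZ //.
  rewrite linearZl_LR (mul_ann1 _ X1).1 /=.
  rewrite combine0 add0r scaler0 addr0 scaler_suml; apply: eq_bigr => j _.
  by rewrite pE scalerA mulrC.
Qed.

Lemma type_triple : has_type A [:: 1%N; 1%N; n] ->
  exists (U : vectType F) (b : {symmetric U}) (g : 'End(U)),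
    admissible_triple b g /\ isomorphic A (tripleAlg b g).
Proof.
move=> tA; have [e e_basis e_orth] := A_evol.
have s_gt0 : all (fun i => 0 < i)%N [:: 1%N; 1%N; n] by rewrite /= n_gt0.
have dim1 : \dim (ann A 1) = 1%N.
  by rewrite (has_type_dim (k := 0) tA s_gt0) //= dimv0.
have dim2 : \dim (ann A 2) = 2%N.
  by rewrite (has_type_dim (k := 1) tA s_gt0) //= dim1.
have full3 : ann A 3 = fullv := has_type_full tA.
have dim3 : \dim {:A} = (2 + n)%N.
  by rewrite -full3 (has_type_dim (k := 2) tA s_gt0) //= dim2.
pose m := #|~: level e 2|.
have dimA : \dim {:A} = (m + 2)%N by rewrite (dim_complement e_basis e_orth 2) dim2.
have m_neq0 : m != 0%N.
  by move: dim3; rewrite dimA addnC => /addnI->; rewrite -lt0n.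
have [x x2 x1] : exists2 x, x \in level e 2 & x \notin level e 1.
  by apply: (exists_levelD e_basis e_orth); rewrite dim1 dim2.
(* [Z] lies in [ann A 1] as [X] lies in [ann A 2], and is nonzero as [X] is outside [ann A 1]; so it
   spans that line. *)
pose X := tnth e x; pose Z := namul A X X.
have Z1 : Z \in ann A 1 by rewrite -(level_sq e_basis e_orth).
have Z_gen v : v \in ann A 1 -> exists c, v = c *: Z.
  have Z0 : Z \notin ann A 0 by rewrite -(level_sq e_basis e_orth).
  move=> v1; have [|c] := vline_complement (ann_subS A 0) _ Z1 Z0 v1.
    by rewrite dim1 dimv0.
  by rewrite memv0 subr_eq0 => /eqP ->; exists c.
rewrite !inE in x1 x2.
have XZ_gen v : v \in ann A 2 -> exists a, v = a.1 *: X + a.2 *: Z.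
  move=> v2; have [|a /Z_gen[c va]] := vline_complement (ann_subS A 1) _ x2 x1 v2.
    by rewrite dim1 dim2.
  by exists (a, c); rewrite /= -va addrC subrK.
pose w j := tnth e (enum_val (A := ~: level e 2) j).
have /fin_all_exists[p pE] j : exists a, namul A (w j) (w j) = a.1 *: X + a.2 *: Z.
  by apply: XZ_gen; rewrite -(level_sq e_basis e_orth) inE full3 memvf.
(* Without the [X] term the square of [w j] would lie in [ann A 1], placing [w j] in [ann A 2]. *)
have p_neq0 j : (p j).1 != 0.
  have := enum_valP j; rewrite inE (level_sq e_basis e_orth) -/(w j) pE.
  by apply: contraNneq => ->; rewrite scale0r add0r memvZ.
pose b : {symmetric 'rV[F]_m} := diag_form (fun j => (p j).1).
(* The quotient makes the form [b (g u) v] diagonal with entries [(p j).2]. *)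
pose g := diag_end (fun j => (p j).2 / (p j).1).
exists 'rV[F]_m, b, g; split.
  by split; [apply: diag_admissible | apply: diag_end_diagonalizable
    | apply: diag_end_symmetric].
have XZ2 a c : a *: X + c *: Z \in ann A 2.
  by rewrite memvD ?memvZ // (subvP (ann_subS A 1)).
have XZM a c a' c' : namul A (a *: X + c *: Z) (a' *: X + c' *: Z) = (a * a') *: Z.
  rewrite linearDl /= !linearZl_LR /= (mul_ann1 _ Z1).1 linearDr /= !linearZr_LR /=.
  by rewrite (mul_ann1 _ Z1).2 !scaler0 !addr0 scalerA.
apply: isomorphic_sym.
apply: (surjective_isomorphic (h := fun y : tripleAlg b g =>
  combine (e := e) y.1.1 + (y.1.2 *: X + y.2 *: Z))).
- by rewrite dim_triple dim_row; apply: esym.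
- move=> k [[u a] c] [[v a'] c'] /=; rewrite combine_linear !scalerDr.
  rewrite !scalerDl -!scalerA [RHS]addrACA; congr (_ + _); exact: addrACA.
- move=> v; have [u uv] := combine_onto e_basis 2 v.
  have [a aE] := XZ_gen _ uv.
  by exists (u, a.1, a.2); rewrite /= -aE addrC subrK.
- move=> [[u a] c] [[v a'] c'] /=.
  rewrite (combine_add_mul e_basis e_orth) // combine0 add0r.
  rewrite XZM scalerDl addrA; congr (_ + _).
  rewrite (diag_form_end (fun j => (p j).1)) !scaler_suml -big_split /=.
  apply: eq_bigr => j _.
  rewrite [(p j).1 * (_ / _)]mulrCA divff // mulr1 -/(w j) pE scalerDr.
  by rewrite !scalerA ![_ * (u 0 j * v 0 j)]mulrC.
Qed.

Lemma type_quadruple : has_type A [:: 1%N; 1%N; 1%N; n] ->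
  exists (U : vectType F) (b : {symmetric U}) (f g : 'End(U)),
    admissible_quadruple b f g /\ isomorphic A (quadrupleAlg b f g).
Proof.
move=> tA; have [e e_basis e_orth] := A_evol.
have s_gt0 : all (fun i => 0 < i)%N [:: 1%N; 1%N; 1%N; n] by rewrite /= n_gt0.
have dim1 : \dim (ann A 1) = 1%N.
  by rewrite (has_type_dim (k := 0) tA s_gt0) //= dimv0.
have dim2 : \dim (ann A 2) = 2%N.
  by rewrite (has_type_dim (k := 1) tA s_gt0) //= dim1.
have dim3 : \dim (ann A 3) = 3%N.
  by rewrite (has_type_dim (k := 2) tA s_gt0) //= dim2.
have full4 : ann A 4 = fullv := has_type_full tA.
have dim4 : \dim {:A} = (3 + n)%N.
  by rewrite -full4 (has_type_dim (k := 3) tA s_gt0) //= dim3.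
pose m := #|~: level e 3|.
have dimA : \dim {:A} = (m + 3)%N by rewrite (dim_complement e_basis e_orth 3) dim3.
have m_neq0 : m != 0%N.
  by move: dim4; rewrite dimA addnC => /addnI->; rewrite -lt0n.
have [x x3 x2] : exists2 x, x \in level e 3 & x \notin level e 2.
  by apply: (exists_levelD e_basis e_orth); rewrite dim2 dim3.
pose X := tnth e x; pose Y := namul A X X; pose Z := namul A Y Y.
have Y2 : Y \in ann A 2 by rewrite -(level_sq e_basis e_orth).
have Y1 : Y \notin ann A 1 by rewrite -(level_sq e_basis e_orth).
(* [Y] lies in [ann A 2] while the basis vector [X] does not, so [Y] has no coordinate along [X]. *)
have XY : namul A X Y = 0.
  by rewrite mul_natural // (coord_ann0 e_basis e_orth Y2 x2) scale0r.
have Z1 : Z \in ann A 1 by have /mem_ann_mod/(_ Y)[] := Y2.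
(* [Y] need not be a natural basis vector, so [level_sq] does not apply; [mul_self_ann1] does. *)
have Z0 : Z \notin ann A 0.
  by rewrite memv0 (mul_self_ann1 e_basis e_orth Y2 Y1) // dim1.
have Z2 : Z \in ann A 2 by apply: (subvP (ann_subS A 1)).
have Z_gen v : v \in ann A 1 -> exists c, v = c *: Z.
  move=> v1; have [|c] := vline_complement (ann_subS A 0) _ Z1 Z0 v1.
    by rewrite dim1 dimv0.
  by rewrite memv0 subr_eq0 => /eqP ->; exists c.
have YZ_gen v : v \in ann A 2 -> exists a c, v = a *: Y + c *: Z.
  move=> v2; have [|a /Z_gen[c va]] := vline_complement (ann_subS A 1) _ Y2 Y1 v2.
    by rewrite dim1 dim2.
  by exists a, c; rewrite -va addrC subrK.
rewrite !inE in x2 x3.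
have XYZ_gen v : v \in ann A 3 ->
    exists a, v = a.1.1 *: X + a.1.2 *: Y + a.2 *: Z.
  move=> v3; have [|a] := vline_complement (ann_subS A 2) _ x3 x2 v3.
    by rewrite dim2 dim3.
  by case/YZ_gen=> c [d va]; exists (a, c, d); rewrite /= -addrA -va addrC subrK.
pose w j := tnth e (enum_val (A := ~: level e 3) j).
have /fin_all_exists[p pE] j :
    exists a, namul A (w j) (w j) = a.1.1 *: X + a.1.2 *: Y + a.2 *: Z.
  by apply: XYZ_gen; rewrite -(level_sq e_basis e_orth) inE full4 memvf.
(* A square in the span of [Y] and [Z] lies in [ann A 2], which would put [w j] in [ann A 3]. *)
have p_neq0 j : (p j).1.1 != 0.
  have := enum_valP j; rewrite inE (level_sq e_basis e_orth) -/(w j) pE.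
  by apply: contraNneq => ->; rewrite scale0r add0r memvD ?memvZ.
pose b : {symmetric 'rV[F]_m} := diag_form (fun j => (p j).1.1).
pose f := diag_end (fun j => (p j).1.2 / (p j).1.1).
pose g := diag_end (fun j => (p j).2 / (p j).1.1).
exists 'rV[F]_m, b, f, g; split.
  split; [exact: diag_admissible | exact: diag_end_comm | split | split].
  - exact: diag_end_diagonalizable.
  - exact: diag_end_diagonalizable.
  - exact: diag_end_symmetric.
  - exact: diag_end_symmetric.
have XYZ3 a c d : a *: X + c *: Y + d *: Z \in ann A 3.
  by rewrite !memvD ?memvZ // (subvP (ann_subS A 2)).
have XYZM a c d a' c' d' :
    namul A (a *: X + c *: Y + d *: Z) (a' *: X + c' *: Y + d' *: Z)
    = (a * a') *: Y + (c * c') *: Z.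
  have YX : namul A Y X = 0 by rewrite (natural_mulC e_basis e_orth).
  rewrite 2!linearDl /= !linearZl_LR /= (mul_ann1 _ Z1).1 scaler0 addr0.
  rewrite !linearDr /= !linearZr_LR /= !(mul_ann1 _ Z1).2 XY YX !scaler0.
  by rewrite !addr0 add0r !scalerA.
apply: isomorphic_sym.
apply: (surjective_isomorphic (h := fun y : quadrupleAlg b f g =>
  combine (e := e) y.1.1.1 + (y.1.1.2 *: X + y.1.2 *: Y + y.2 *: Z))).
- by rewrite dim_quadruple dim_row; apply: esym.
- move=> k [[[u a] c] d] [[[v a'] c'] d'] /=; rewrite combine_linear !scalerDr.
  rewrite !scalerDl -!scalerA [RHS]addrACA; congr (_ + _).
  by rewrite [RHS]addrACA; congr (_ + _); rewrite [RHS]addrACA.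
- move=> v; have [u uv] := combine_onto e_basis 3 v.
  have [a aE] := XYZ_gen _ uv.
  by exists (u, a.1.1, a.1.2, a.2); rewrite /= -aE addrC subrK.
- move=> [[[u a] c] d] [[[v a'] c'] d'] /=.
  rewrite (combine_add_mul e_basis e_orth) // combine0 add0r.
  rewrite XYZM (diag_form_end (fun j => (p j).1.1)) //.
  rewrite (diag_form_end (fun j => (p j).1.1)) //.
  rewrite !scalerDl -addrA [X in _ + X]addrACA addrA; congr (_ + _).
  rewrite !scaler_suml -!big_split /=; apply: eq_bigr => j _.
  rewrite ![(p j).1.1 * (_ / _)]mulrCA divff // !mulr1 -/(w j) pE !scalerDr.
  by rewrite !scalerA ![_ * (u 0 j * v 0 j)]mulrC addrA.
Qed.

End Existence.

Theorem theorem4p7 (F : fieldType) (F_char : 2%N \notin [pchar F])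
    (n : nat) (n_ge1 : (1 <= n)%N)
    (E : nonassocAlg F) (E_evol : evolution_algebra E) (E_nil : nilpotent E) :
  [/\ (* (i) *)
      (has_type E [:: 1%N; n] ->
         exists (U : vectType F) (b : {symmetric U}),
           admissible_pair b /\ isomorphic E (pairAlg b))
      /\
      (forall (U U' : vectType F) (b : {symmetric U}) (b' : {symmetric U'}),
         admissible_pair b -> admissible_pair b' ->
         isomorphic (pairAlg b) (pairAlg b')
         <->
         exists (psi : 'Hom(U, U')) (mu : F), is_similarity b b' psi mu),

      (* (ii) *)
      (has_type E [:: 1%N; 1%N; n] ->
         exists (U : vectType F) (b : {symmetric U}) (g : 'End(U)),
           admissible_triple b g /\ isomorphic E (tripleAlg b g))
      /\
      (forall (U U' : vectType F) (b : {symmetric U}) (b' : {symmetric U'})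
              (g : 'End(U)) (g' : 'End(U')),
         admissible_triple b g -> admissible_triple b' g' ->
         isomorphic (tripleAlg b g) (tripleAlg b' g')
         <->
         exists (psi : 'Hom(U, U')) (mu nu : F),
           is_similarity b b' psi mu /\
           (psi^-1 \o g' \o psi)%VF = mu *: g + (mu^-1 * nu) *: \1%VF)
    & (* (iii) *)
      (has_type E [:: 1%N; 1%N; 1%N; n] ->
         exists (U : vectType F) (b : {symmetric U}) (f g : 'End(U)),
           admissible_quadruple b f g /\ isomorphic E (quadrupleAlg b f g))
      /\
      (forall (U U' : vectType F) (b : {symmetric U}) (b' : {symmetric U'})
              (f g : 'End(U)) (f' g' : 'End(U')),
         admissible_quadruple b f g -> admissible_quadruple b' f' g' ->
         isomorphic (quadrupleAlg b f g) (quadrupleAlg b' f' g')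
         <->
         exists (psi : 'Hom(U, U')) (mu nu : F),
           [/\ is_similarity b b' psi mu,
               (psi^-1 \o f' \o psi)%VF = mu *: f
             & (psi^-1 \o g' \o psi)%VF
               = mu ^+ 3 *: g + (mu^-1 * nu) *: \1%VF])].
Proof.
split; (split; first by [apply: type_pair | apply: type_triple
  | apply: type_quadruple]).
- move=> U U' b b' [_ b_nd] [_ b'_nd]; split; first exact: pair_iso_similarity.
  by case=> psi [mu]; apply: similarity_pair_iso.
- move=> U U' b b' g g' [[_ b_nd] _ _] [[_ b'_nd] _ _].
  split; first exact: triple_iso_similarity.
  by case=> psi [mu [nu []]]; apply: similarity_triple_iso.
- move=> U U' b b' f g f' g' [[_ b_nd] _ _ _] [[_ b'_nd] _ _ _].
  split; first exact: quadruple_iso_similarity.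
  by case=> psi [mu [nu []]]; apply: similarity_quadruple_iso.
Qed.
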